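(* Let $G_1$ be an $r_1$-regular graph with $n_1$ vertices and $m_1$ edges and let $G_2$ be an arbitrary graph with $n_2$ vertices. Then the signless Laplacian characteristic polynomial of the central vertex corona $G_1\odot G_2$ is (as an identity of rational functions in $x$) $$\begin{aligned}f(Q(G_1\odot G_2),x)=\;&(x-2)^{m_1-n_1}\prod_{j=1}^{n_2}\big(x-1-\gamma_j(G_2)\big)^{n_1}\\&\times\prod_{i=1}^{n_1}\Big[\Big(x-n_1-n_2+2-\chi_{Q(G_2)}(x-1)-\frac{r_1}{x-2}\Big)(x-2)-(x-2)P(\lambda_i(G_1))+(x-3)\lambda_i(G_1)\Big].\end{aligned}$$
   Context: All graphs are finite, simple and connected. For a graph $G$ on $n$ vertices, $A(G)$ is its adjacency matrix with eigenvalues $\lambda_1(G)\ge\dots\ge\lambda_n(G)$; $D(G)$ is the diagonal matrix of vertex degrees; $Q(G)=D(G)+A(G)$ is the signless Laplacian matrix with eigenvalues $\gamma_1(G)\ge\gamma_2(G)\ge\dots\ge\gamma_n(G)$. For an $n\times n$ matrix $M$, $f(M,x)=\det(xI_n-M)$, and $\chi_M(x)=\mathbf 1^T(xI_n-M)^{-1}\mathbf 1$ is the sum of all entries of $(xI_n-M)^{-1}$ (the $M$-coronal); $\chi_{Q(G_2)}(x-1)$ is this function evaluated at $x-1$. $P$ denotes the polynomial associated with $G_1$: if $G_1$ is connected $r_1$-regular on $n_1$ vertices with distinct adjacency eigenvalues $r_1=\theta_1,\theta_2,\dots,\theta_t$, then $P(x)=n_1\prod_{k=2}^t\frac{x-\theta_k}{r_1-\theta_k}$;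 thus $P(A(G_1))$ is the all-ones matrix, $P(r_1)=n_1$ and $P(\theta_k)=0$ for $k\ge2$. The central graph $C(G)$ of $G$ is obtained from $G$ by subdividing each edge of $G$ exactly once and joining all pairs of distinct vertices of $G$ that are nonadjacent in $G$. The central vertex corona $G_1\odot G_2$ is obtained by taking one copy of $C(G_1)$ and $|V(G_1)|$ copies of $G_2$, and joining the vertex $v_i$ of $G_1$ (viewed in $C(G_1)$) to every vertex in the $i$-th copy of $G_2$, for each $i$. *)

(* Defs.v *)
From HB Require Import structures.
From mathcomp Require Import all_boot all_order all_algebra.
From mathcomp Require Import polyrcf.

Set Implicit Arguments.
Unset Strict Implicit.
Unset Printing Implicit Defensive.

Import Order.TTheory GRing.Theory Num.Theory.
Local Open Scope ring_scope.

Record sgraph := SGraph {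
  vertex :> finType;
  adj : rel vertex;
  adj_sym : symmetric adj;
  adj_irrefl : irreflexive adj }.

Definition connected (G : sgraph) : Prop :=
  (0 < #|G|)%N /\ forall u v : G, connect (@adj G) u v.

Definition degree (G : sgraph) (u : G) : nat := #|[set v : G | adj u v]|.

Definition regular (G : sgraph) (r : nat) : Prop :=
  forall u : G, degree u = r.

Definition edges (G : sgraph) : {set {set G}} :=
  [set E : {set G} | [exists u, exists v, adj u v && (E == [set u; v])]].

Definition edge (G : sgraph) : finType := {E : {set G} | E \in edges G}.

(* An edge, seen as an element of the right summand, is the vertex that
   subdivides it. *)
Section CentralGraph.
Variable G : sgraph.

Definition central_adj : rel (G + edge G)%type := fun a b =>
  match a, b with
  | inl u, inl v => (u != v) && ~~ adj u v
  | inl u, inr E => u \in val E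
  | inr E, inl u => u \in val E
  | inr _, inr _ => false
  end.

Lemma central_adj_sym : symmetric central_adj.
Proof. by case=> [u|E] [v|E'] //=; rewrite eq_sym adj_sym. Qed.

Lemma central_adj_irrefl : irreflexive central_adj.
Proof. by case=> [u|E] //=; rewrite eqxx. Qed.

Definition central_graph : sgraph := SGraph central_adj_sym central_adj_irrefl.

End CentralGraph.

(* [inr (v, w)] is the vertex w of the copy of G2 attached to v. *)
Section CentralVertexCorona.
Variables G1 G2 : sgraph.

Definition corona_adj : rel (central_graph G1 + G1 * G2)%type := fun a b =>
  match a, b with
  | inl c, inl d => adj c d
  | inl (inl u), inr (v, _) => u == v
  | inr (v, _), inl (inl u) => u == v
  | inl (inr _), inr _ => false
  | inr _, inl (inr _) => false
  | inr (u, w), inr (v, z) => (u == v) && adj w z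
  end.

Lemma corona_adj_sym : symmetric corona_adj.
Proof.
by case=> [[u|E]|[u w]] [[v|E']|[v z]] //=;
  rewrite ?[v == u]eq_sym 1?adj_sym // [adj z w]adj_sym.
Qed.

Lemma corona_adj_irrefl : irreflexive corona_adj.
Proof. by case=> [[u|E]|[u w]] //=; rewrite ?eqxx // adj_irrefl. Qed.

Definition central_vertex_corona : sgraph :=
  SGraph corona_adj_sym corona_adj_irrefl.

End CentralVertexCorona.

Section GraphMatrices.
Variables (R : pzRingType) (G : sgraph).

Definition adjmx : 'M[R]_#|G| :=
  \matrix_(i, j) (adj (enum_val i) (enum_val j))%:R.

Definition degmx : 'M[R]_#|G| :=
  diag_mx (\row_i (degree (enum_val i))%:R).

Definition signless_laplacian : 'M[R]_#|G| := degmx + adjmx.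

End GraphMatrices.

Section Spectrum.
Variable R : rcfType.

(* Real eigenvalues, listed with algebraic multiplicity in nonincreasing order
   ([rootsR] is increasing and duplicate-free). For a symmetric matrix of order
   n all eigenvalues are real, so the list has length n. *)
Definition eigenvalues n (M : 'M[R]_n) : seq R :=
  rev (flatten [seq nseq (mup a (char_poly M)) a | a <- rootsR (char_poly M)]).

Definition adj_eigenvalues (G : sgraph) : seq R := eigenvalues (adjmx R G).

Definition signless_eigenvalues (G : sgraph) : seq R :=
  eigenvalues (signless_laplacian R G).

(* For G connected and r-regular, theta_1 = r; the product thus runs over the
   distinct eigenvalues theta_2, ..., theta_t. *)
Definition regular_poly (G : sgraph) (r : nat) : {poly R} :=
  #|G|%:R *: \prod_(theta <- undup (adj_eigenvalues G) | theta != r%:R)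
               ((r%:R - theta)^-1 *: ('X - theta%:P)).

Definition ratfun : fieldType := {fraction {poly R}}.

Definition of_poly (p : {poly R}) : ratfun := tofrac p.

Definition of_const (c : R) : ratfun := of_poly c%:P.

(* The value of the M-coronal at the rational function y. *)
Definition coronal n (M : 'M[R]_n) (y : ratfun) : ratfun :=
  \sum_i \sum_j invmx (y%:M - map_mx of_const M) i j.

End Spectrum.

(* Main.v *)
From HB Require Import structures.
Require Import Defs.
From mathcomp Require Import all_boot all_order all_algebra.
From mathcomp Require Import perm polyrcf complex spectral ring.

(** Write [Q] for the signless Laplacian of the corona. Over the rational
    functions the matrix [x I - Q], in blocks along the vertices of [G1], the
    subdivision vertices and the copies of [G2], has a tensor product
    [I (x) (x - 1 - Q(G2))] as its last diagonal block and the scalar matrix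
    [x - 2] as its middle one. Eliminating the copies ([fdet_copies]) gives the
    factor [det (x - 1 - Q(G2)) ^ n1] and subtracts the coronal of [Q(G2)] from
    the diagonal of the first block; eliminating the subdivision vertices
    ([fdet_central]) gives [(x - 2) ^ m1] and subtracts [(A + r I) / (x - 2)],
    because [A + r I] is the product of the incidence matrix of [G1] with its
    transpose ([sum_incidence]). What remains is a matrix [a I - J + c A] on the
    vertices of [G1], where [J] is the all-ones matrix.

    A real symmetric matrix is diagonalizable over [R] ([sym_diagonalizable]),
    so its list of eigenvalues is its diagonal form ([perm_eigenvalues]). For a
    connected regular graph the eigenvectors of the degree are the constant
    ones, whence [J = P(A)] ([regular_poly_adjmx]) and the basis that
    diagonalizes [A] also diagonalizes [a I - J + c A]; its determinant is a
    product over the eigenvalues of [A] ([fdet_regular]). The factor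
    [(x - 2) ^ (- n1)] of the theorem accounts for multiplying each of the [n1]
    factors of that product by [x - 2].

    The computation is carried out over an arbitrary field [K] with a morphism
    [R -> K] and an element [x] of [K] outside the image of [R]. *)

Set Implicit Arguments.
Unset Strict Implicit.
Unset Printing Implicit Defensive.

Import Order.TTheory GRing.Theory Num.Theory.
Local Open Scope ring_scope.

(** * Eigenvalues of real symmetric matrices *)

(** The spectral theorem over [R[i]] gives a unitary change of basis and a real
    diagonal; two real matrices that are similar over [R[i]] are similar through
    a real matrix. *)
Lemma sym_diagonalizable (R : rcfType) n (A : 'M[R]_n) : A^T = A ->
  exists S d, S \in unitmx /\ S *m A = diag_mx d *m S.
Proof.
move=> symA; pose toC := real_complex R; pose AC := map_mx toC A.
have realC m p (B : 'M[R]_(m, p)) : map_mx toC B \is a realmx.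
  by apply/mxOverP => i j; rewrite mxE; apply/complex_realP; exists (B i j).
have complexK m p (B : 'M[R[i]]_(m, p)) :
    B \is a realmx -> exists B0, B = map_mx toC B0.
  move=> /mxOverP realB; exists (map_mx (@complex.Re R) B).
  by apply/matrixP => i j; rewrite !mxE /toC RRe_real.
have hermA : AC \is hermsymmx.
  apply: realsym_hermsym; last exact: realC.
  rewrite qualifE /= expr0 scale1r.
  by rewrite map_mx_id // map_trmx symA.
have reald := hermitian_spectral_diag_real hermA.
have /orthomx_spectralP defA := hermitian_normalmx hermA.
have [d0 defd] := complexK _ _ _ reald.
have /real_similar : exists2 S, S \in unitmx &
    conjmx S AC == diag_mx (spectral_diag AC).
  exists (spectralmx AC); first exact: spectral_unit.
  apply/(simmxP (spectral_unit _)); rewrite [X in _ *m X = _]defA !mulmxA.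
  by rewrite mulmxV ?spectral_unit // mul1mx.
case=> [||S /andP[/= realS unitS] /(simmxP unitS)].
- exact: realC.
- by rewrite defd -map_diag_mx; apply: realC.
have [S0 defS] := complexK _ _ _ realS; exists S0, d0; split.
  by rewrite -(map_unitmx toC) -defS.
by apply: (@map_mx_inj _ _ toC); rewrite !map_mxM map_diag_mx -defd -defS.
Qed.

Lemma det_similar_diag (K : fieldType) n (S M : 'M[K]_n) (d : 'rV_n) :
  S \in unitmx -> S *m M = diag_mx d *m S -> \det M = \prod_i d 0 i.
Proof.
move=> unitS /(congr1 determinant); rewrite !det_mulmx mulrC det_diag.
by move/(mulIf _)=> -> //; move: unitS; rewrite unitmxE unitfE.
Qed.

Lemma char_poly_similar_diag (R : fieldType) n (S A : 'M[R]_n) (d : 'rV_n) :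
  S \in unitmx -> S *m A = diag_mx d *m S ->
  char_poly A = \prod_(a <- [seq d 0 i | i <- enum 'I_n]) ('X - a%:P).
Proof.
move=> unitS SA; rewrite /char_poly big_map big_enum /=.
have: map_mx polyC S *m char_poly_mx A =
      diag_mx (\row_i ('X - (d 0 i)%:P)) *m map_mx polyC S.
  rewrite mulmxBr -map_mxM SA map_mxM map_diag_mx scalar_mxC -mulmxBl.
  congr (_ *m _); apply/matrixP => i j; rewrite !mxE.
  by case: eqP => //; rewrite !(mulr1n, mulr0n, subr0).
move/(congr1 determinant); rewrite !det_mulmx mulrC det_diag => /mulIf -> //.
  by apply: eq_bigr => i _; rewrite mxE.
by rewrite det_map_mx polyC_eq0 -unitfE -unitmxE.
Qed.

(** Both lists contain each [a] as many times as [a] is a root of the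
    characteristic polynomial. *)
Lemma perm_eigenvalues (R : rcfType) n (S A : 'M[R]_n) (d : 'rV_n) :
  S \in unitmx -> S *m A = diag_mx d *m S ->
  perm_eq (eigenvalues A) [seq d 0 i | i <- enum 'I_n].
Proof.
move=> unitS SA; rewrite /eigenvalues perm_rev.
have p_neq0 : char_poly A != 0 by rewrite monic_neq0 ?char_poly_monic.
apply/allP => a _; apply/eqP.
have -> : count_mem a [seq d 0 i | i <- enum 'I_n] = mup a (char_poly A).
  by rewrite (char_poly_similar_diag unitS SA) mu_prod_XsubC.
rewrite count_flatten sumnE big_map big_map.
under eq_bigr do rewrite count_nseq.
have [ra|ra] := boolP (a \in rootsR (char_poly A)).
  rewrite (bigD1_seq a) ?uniq_roots //= eqxx mul1n big1 ?addn0 // => b.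
  by move/negPf=> ->.
rewrite big_seq big1 => [|b rb].
  rewrite mupNroot //; apply: contra ra => ra.
  by rewrite -(roots_on_rootsR p_neq0) ra inE.
by rewrite /= (negPf (memPn ra b rb)).
Qed.

Lemma prod_eigenvalues (R : rcfType) (K : comNzRingType) (F : R -> K) n
    (S A : 'M[R]_n) (d : 'rV_n) :
  S \in unitmx -> S *m A = diag_mx d *m S ->
  \prod_(i < n) F (eigenvalues A)`_i = \prod_i F (d 0 i).
Proof.
move=> unitS SA; have eqd := perm_eigenvalues unitS SA.
have sz : size (eigenvalues A) = n.
  by rewrite (perm_size eqd) size_map size_enum_ord.
rewrite -(big_mkord xpredT (fun i => F (eigenvalues A)`_i)) -{1}sz.
by rewrite -(big_nth 0 xpredT F) (perm_big _ eqd) big_map big_enum.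
Qed.

(** * Determinants indexed by finite types *)

(** The matrix whose rows and columns are indexed by finite types, numbered by
    their enumerations. *)
Definition fmx (K : Type) (T1 T2 : finType) (F : T1 -> T2 -> K) :
    'M_(#|T1|, #|T2|) :=
  \matrix_(i, j) F (enum_val i) (enum_val j).

(** The determinant of a square matrix indexed by a finite type. *)
Definition fdet (K : comPzRingType) (T : finType) (F : T -> T -> K) : K :=
  \det (fmx F).

Lemma sum_enum_val (K : nmodType) (T : finType) (F : T -> K) :
  \sum_(i < #|T|) F (enum_val i) = \sum_t F t.
Proof. by rewrite -(big_enum_val F). Qed.

Lemma eq_fdet (K : comPzRingType) (T : finType) (F G : T -> T -> K) :
  (forall a b, F a b = G a b) -> fdet F = fdet G.
Proof. by move=> eqFG; congr (\det _); apply/matrixP=> i j; rewrite !mxE. Qed.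

Lemma fmxM (K : pzRingType) (T1 T2 T3 : finType) (F : T1 -> T2 -> K)
    (G : T2 -> T3 -> K) :
  fmx (fun a c => \sum_b F a b * G b c) = fmx F *m fmx G.
Proof.
apply/matrixP => i j; rewrite !mxE -sum_enum_val.
by apply: eq_bigr => k _; rewrite !mxE.
Qed.

Lemma fmx1 (K : pzRingType) (T : finType) :
  @fmx K T T (fun a b => (a == b)%:R) = 1%:M.
Proof. by apply/matrixP=> i j; rewrite !mxE (inj_eq enum_val_inj). Qed.

(** The determinant does not depend on how the indices are numbered. *)
Lemma det_bij (K : comPzRingType) n (T : finType) (g : 'I_n -> T)
    (F : T -> T -> K) : bijective g ->
  \det (\matrix_(i, j) F (g i) (g j)) = fdet F.
Proof.
move=> bij_g; have en : n = #|T| by rewrite -(bij_eq_card bij_g) card_ord.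
subst n; have inj_s : injective (enum_rank \o g).
  by move=> i j /= /enum_rank_inj/(bij_inj bij_g).
rewrite /fdet; set M := fmx _; pose s := perm inj_s.
have -> : \matrix_(i, j) F (g i) (g j) = row_perm s (col_perm s M).
  by apply/matrixP => i j; rewrite !mxE !permE /= !enum_rankK.
rewrite row_permE col_permE !det_mulmx !det_perm odd_permV mulrA mulrAC.
by rewrite -expr2 sqrr_sign mul1r.
Qed.

Lemma fdet_bij (K : comPzRingType) (T T' : finType) (g : T -> T')
    (F : T' -> T' -> K) : bijective g ->
  fdet (fun a b => F (g a) (g b)) = fdet F.
Proof.
by move=> bij_g; apply: (det_bij (g := g \o enum_val)); apply: bij_comp => //;
   apply: enum_val_bij.
Qed.

Lemma fdet_sum (K : comPzRingType) (T1 T2 : finType)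
    (F : T1 + T2 -> T1 + T2 -> K) :
  fdet F = \det (block_mx (fmx (fun a b => F (inl a) (inl b)))
                          (fmx (fun a b => F (inl a) (inr b)))
                          (fmx (fun a b => F (inr a) (inl b)))
                          (fmx (fun a b => F (inr a) (inr b)))).
Proof.
pose g (i : 'I_(#|T1| + #|T2|)) : T1 + T2 :=
  match split i with inl a => inl (enum_val a) | inr b => inr (enum_val b) end.
rewrite -(det_bij (g := g)); last first.
  apply: inj_card_bij; last by rewrite card_sum card_ord.
  move=> i j; rewrite /g -{2}(splitK i) -{2}(splitK j).
  by case: (split i) (split j) => a [] b // [] /enum_val_inj ->.
congr (\det _); apply/matrixP => i j; rewrite /block_mx !mxE /g.
by case: (split i) => a; rewrite !mxE; case: (split j) => b; rewrite !mxE.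
Qed.

(** Schur complement of the lower right block, with [E] the inverse of that
    block. *)
Lemma fdet_schur (K : comPzRingType) (T1 T2 : finType)
    (F : T1 + T2 -> T1 + T2 -> K) (E : T2 -> T2 -> K) :
    (forall c d, \sum_e F (inr c) (inr e) * E e d = (c == d)%:R) ->
  fdet F = fdet (fun c d => F (inr c) (inr d)) *
    fdet (fun a b => F (inl a) (inl b) -
      \sum_c \sum_d F (inl a) (inr c) * E c d * F (inr d) (inl b)).
Proof.
move=> FE; rewrite fdet_sum /fdet.
set A := fmx (fun a b => F (inl a) (inl b)).
set B := fmx (fun a b => F (inl a) (inr b)).
set C := fmx (fun a b => F (inr a) (inl b)).
set D := fmx (fun a b => F (inr a) (inr b)).
have DE : D *m fmx E = 1%:M.
  by rewrite -fmxM -fmx1; apply/matrixP => i j; rewrite !mxE FE.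
have -> : fmx (fun a b => F (inl a) (inl b) -
      \sum_c \sum_d F (inl a) (inr c) * E c d * F (inr d) (inl b)) =
    A - B *m fmx E *m C.
  rewrite -!fmxM; apply/matrixP => i j; rewrite !mxE exchange_big /=.
  by congr (_ - _); apply: eq_bigr => d _; rewrite mulr_suml.
have <- : \det (block_mx A B C D *m block_mx 1%:M 0 (- (fmx E *m C)) 1%:M)
    = \det (block_mx A B C D).
  by rewrite det_mulmx det_lblock !det1 !mulr1.
rewrite mulmx_block !mulmx1 !mulmx0 !add0r !mulmxN !mulmxA DE mul1mx subrr.
by rewrite det_ublock mulrC.
Qed.

(** The determinant of the tensor product of an identity matrix with [B]. *)
Lemma fdet_tensor1 (K : comPzRingType) (T1 T2 : finType) (B : T2 -> T2 -> K) :
  @fdet K (T1 * T2)%type (fun p q => (p.1 == q.1)%:R * B p.2 q.2) =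
    fdet B ^+ #|T1|.
Proof.
(* Induction on the size of [T1], after replacing it with an ordinal type. *)
pose I n (p q : 'I_n * T2) : K := (p.1 == q.1)%:R * B p.2 q.2.
suff detI n : fdet (I n) = fdet B ^+ n.
  rewrite -detI -(@fdet_bij _ ('I_#|T1| * T2)%type _
    (fun p => (enum_val p.1, p.2))); last first.
    exists (fun p => (enum_rank p.1, p.2)) => [] [i t] /=.
      by rewrite enum_valK.
    by rewrite enum_rankK.
  by apply: eq_fdet => p q; rewrite /I /= (inj_eq enum_val_inj).
elim: n => [|n IHn].
  rewrite expr0 /fdet; set M := fmx _; move: M.
  by rewrite card_prod card_ord mul0n => M; rewrite det_mx00.
pose g (s : T2 + 'I_n * T2) : 'I_n.+1 * T2 :=
  match s with inl t => (ord0, t) | inr p => (lift ord0 p.1, p.2) end.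
rewrite -(fdet_bij (g := g)); last first.
  apply: inj_card_bij; last by rewrite card_sum !card_prod !card_ord mulSn.
  case=> [t|[i t]] [u|[j u]] //=; first by case=> ->.
  move=> eq_ij; have /lift_inj -> := congr1 fst eq_ij.
  by have /= -> := congr1 snd eq_ij.
rewrite fdet_sum exprS -IHn.
have -> : fmx (fun a b => I n.+1 (g (inl a)) (g (inr b))) = 0.
  by apply/matrixP => i j; rewrite !mxE /I /= mul0r.
rewrite det_lblock; congr (_ * _).
by apply: eq_fdet => a b; rewrite /I /= mul1r.
Qed.

(** * The all-ones matrix as a polynomial in the adjacency matrix *)

Lemma degree_sum (G : sgraph) (u : G) : degree u = (\sum_v adj u v)%N.
Proof.
by rewrite /degree -sum1dep_card big_mkcond; apply: eq_bigr => v; case: ifP.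
Qed.

Lemma natr_degree (K : pzRingType) (G : sgraph) (u : G) :
  \sum_v (adj u v)%:R = (degree u)%:R :> K.
Proof. by rewrite degree_sum natr_sum. Qed.

(** The Laplacian quadratic form of [y], the sum of the [(y u - y v) ^ 2] over
    adjacent pairs, vanishes. *)
Lemma regular_eigenvector_const (R : realDomainType) (G : sgraph) (r : nat)
    (y : G -> R) :
    connected G -> regular G r ->
    (forall u, \sum_v (adj u v)%:R * y v = r%:R * y u) ->
  forall u v, y u = y v.
Proof.
move=> [_ connG] regG eigy.
have sum0 : \sum_u \sum_v (adj u v)%:R * (y u - y v) ^+ 2 = 0.
  have expand u : \sum_v (adj u v)%:R * (y u - y v) ^+ 2 =
      \sum_v (adj u v)%:R * y v ^+ 2 - r%:R * y u ^+ 2.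
    transitivity (\sum_v (adj u v)%:R * y v ^+ 2
        + (\sum_v (adj u v)%:R) * y u ^+ 2
        - 2 * y u * \sum_v (adj u v)%:R * y v).
      rewrite mulr_sumr mulr_suml -big_split -sumrB /=.
      by apply: eq_bigr => v _; ring.
    by rewrite natr_degree regG eigy; ring.
  under eq_bigr do rewrite expand.
  rewrite sumrB exchange_big /= -sumrB big1 // => v _.
  under eq_bigr do rewrite adj_sym.
  by rewrite -mulr_suml natr_degree regG subrr.
have eq_adj u v : adj u v -> y u = y v.
  move=> uv; have ge0 a b : 0 <= (adj a b)%:R * (y a - y b) ^+ 2.
    by rewrite mulr_ge0 ?ler0n ?sqr_ge0.
  have sumu0 : \sum_w (adj u w)%:R * (y u - y w) ^+ 2 = 0.
    by apply: (psumr_eq0P _ sum0) => // a _; apply: sumr_ge0.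
  have /eqP : (adj u v)%:R * (y u - y v) ^+ 2 = 0.
    by apply: (psumr_eq0P _ sumu0).
  by rewrite uv mul1r sqrf_eq0 subr_eq0 => /eqP.
move=> u v; have closed_y : closed (@adj G) [pred w | y w == y u].
  by move=> a b /eq_adj ab; rewrite !inE ab.
have := closed_connect closed_y (connG u v).
by rewrite !inE eqxx => /esym/eqP ->.
Qed.

Lemma adjmx_sym (R : pzRingType) (G : sgraph) : (adjmx R G)^T = adjmx R G.
Proof. by apply/matrixP => i j; rewrite !mxE adj_sym. Qed.

Lemma signless_laplacian_sym (R : pzRingType) (G : sgraph) :
  (signless_laplacian R G)^T = signless_laplacian R G.
Proof. by rewrite /signless_laplacian linearD /= tr_diag_mx adjmx_sym. Qed.

Lemma regular_adjmx_eigen (R : realDomainType) (G : sgraph) (r p : nat)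
    (H : 'M[R]_(#|G|, p)) :
    connected G -> regular G r -> adjmx R G *m H = r%:R *: H ->
  forall i j k, H i k = H j k.
Proof.
move=> connG regG AH i j k; pose y u := H (enum_rank u) k.
have -> : H i k = y (enum_val i) by rewrite /y enum_valK.
have -> : H j k = y (enum_val j) by rewrite /y enum_valK.
apply: (regular_eigenvector_const connG regG) => u.
have /matrixP/(_ (enum_rank u) k) := AH; rewrite !mxE => <-.
rewrite -sum_enum_val; apply: eq_bigr => l _.
by rewrite !mxE enum_rankK /y enum_valK.
Qed.

Lemma horner_regular_poly_deg (R : rcfType) (G : sgraph) (r : nat) :
  (regular_poly R G r).[r%:R] = #|G|%:R.
Proof.
rewrite /regular_poly hornerZ horner_prod big1 ?mulr1 // => a a_neq.
by rewrite hornerZ hornerXsubC mulVf // subr_eq0 eq_sym.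
Qed.

Lemma horner_regular_poly_root (R : rcfType) (G : sgraph) (r : nat) (a : R) :
  a \in adj_eigenvalues R G -> a != r%:R -> (regular_poly R G r).[a] = 0.
Proof.
move=> a_eig a_neq; rewrite /regular_poly hornerZ horner_prod.
rewrite (big_rem a) ?mem_undup //=.
by rewrite a_neq hornerZ hornerXsubC subrr mulr0 mul0r mulr0.
Qed.

(** In the basis given by the rows of [S], which diagonalizes the adjacency
    matrix [A], the all-ones matrix becomes [P(D)]; that is, [P(A)] is the
    all-ones matrix. *)
Lemma regular_poly_adjmx (R : rcfType) (G : sgraph) (r : nat)
    (S : 'M[R]_#|G|) (d : 'rV_#|G|) :
    connected G -> regular G r -> S \in unitmx ->
    S *m adjmx R G = diag_mx d *m S ->
  S *m const_mx 1 = diag_mx (map_mx (horner (regular_poly R G r)) d) *m S.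
Proof.
move=> connG regG unitS SA; set P := regular_poly R G r; set A := adjmx R G.
pose D := diag_mx (map_mx (horner P) d); pose H := invmx S *m D *m S.
(* [P] vanishes at the eigenvalues other than [r], so [P(A) (A - r) = 0]. *)
have eig_d i : (d 0 i - r%:R) * P.[d 0 i] = 0.
  have [->|d_neq] := eqVneq (d 0 i) r%:R; first by rewrite subrr mul0r.
  rewrite horner_regular_poly_root ?mulr0 //.
  by rewrite (perm_mem (perm_eigenvalues unitS SA)) map_f ?mem_enum.
have AS : A = invmx S *m diag_mx d *m S by rewrite -mulmxA -SA mulKmx.
have DD : diag_mx d *m D = r%:R *: D.
  rewrite mulmx_diag -linearZ /=; congr diag_mx; apply/rowP => i; rewrite !mxE.
  by apply/eqP; rewrite -subr_eq0 -mulrBl eig_d.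
have HA : H *m A = r%:R *: H.
  rewrite AS /H !mulmxA mulmxK // -[invmx S *m D *m _]mulmxA.
  rewrite [D *m _]diag_mx_comm DD.
  by rewrite -scalemxAr -scalemxAl.
have eqHr i j k : H k i = H k j.
  have AHT : A *m H^T = r%:R *: H^T.
    by rewrite -[A]adjmx_sym -trmx_mul HA linearZ.
  have := regular_adjmx_eigen connG regG AHT i j k.
  by rewrite [LHS]mxE [RHS]mxE.
pose e : 'cV[R]_#|G| := const_mx 1.
have Ae : A *m e = r%:R *: e.
  apply/colP => i; rewrite !mxE -(regG (enum_val i)) mulr1 -natr_degree.
  by rewrite -[RHS]sum_enum_val; apply: eq_bigr => j _; rewrite !mxE mulr1.
(* On the [r]-eigenvector [e], [P(A)] acts as [P(r)], the number of
   vertices. *)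
have He : H *m e = #|G|%:R *: e.
  have dS : diag_mx d *m (S *m e) = r%:R *: (S *m e).
    by rewrite mulmxA -SA -mulmxA Ae scalemxAr.
  have : D *m (S *m e) = #|G|%:R *: (S *m e).
    move: (S *m e) dS => v; rewrite !mul_diag_mx => dv.
    apply/colP => i; have /colP/(_ i) := dv; rewrite !mxE => /eqP.
    rewrite -subr_eq0 -mulrBl mulf_eq0 subr_eq0 => /orP[/eqP ->|/eqP ->].
      by rewrite horner_regular_poly_deg.
    by rewrite !mulr0.
  by move=> DS; rewrite /H -!mulmxA DS -scalemxAr mulKmx.
(* [H] has constant rows, each with sum [#|G|]. *)
suff H1 : H = const_mx 1 by rewrite -H1 /H !mulmxA mulmxV ?mul1mx.
move: (H) eqHr He => M eqMr Me; apply/matrixP => i j; rewrite mxE.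
have nz_n : #|G|%:R != 0 :> R by rewrite pnatr_eq0 -lt0n; case: connG.
apply: (mulfI nz_n); have /colP/(_ i) := Me; rewrite /e !mxE => <-.
transitivity (\sum_(k < #|G|) M i j).
  by rewrite mulr_natl sumr_const card_ord.
by apply: eq_bigr => k _; rewrite mxE mulr1 (eqMr k j i).
Qed.

(** * Incidence and degrees in the central vertex corona *)

Lemma mem_edges (G : sgraph) (E : {set G}) :
  reflect (exists u v, adj u v /\ E = [set u; v]) (E \in edges G).
Proof.
rewrite inE; apply: (iffP existsP) => [[u /existsP[v /andP[uv /eqP->]]]|].
  by exists u, v.
by move=> [u [v [uv ->]]]; exists u; apply/existsP; exists v; rewrite uv eqxx.
Qed.

Lemma card_edge (G : sgraph) : #|edge G| = #|edges G|.
Proof. by rewrite card_sig; apply: eq_card => E; rewrite inE. Qed.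

Lemma adj_neq (G : sgraph) (u v : G) : adj u v -> u != v.
Proof. by apply: contraTneq => ->; rewrite adj_irrefl. Qed.

Lemma card_edge_set (G : sgraph) (E : edge G) : #|val E| = 2%N.
Proof.
have /mem_edges[u [v [/adj_neq uv ->]]] := valP E.
by rewrite cards2 uv.
Qed.

(** The entries of the product of the incidence matrix with its transpose: two
    distinct vertices are joined by at most one edge. *)
Lemma sum_incidence (G : sgraph) (u v : G) :
  (\sum_(E : edge G) (u \in val E) * (v \in val E) =
    (u == v) * degree u + adj u v)%N.
Proof.
pose W := [set E in edges G | (u \in E) && (v \in E)].
have inW E : (E \in W) = [&& E \in edges G, u \in E & v \in E].
  by rewrite [LHS]inE.
transitivity #|W|.
  rewrite -sum1_card -(big_sub (edges G)
    (fun E : {set G} => (u \in E) * (v \in E))%N).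
  rewrite big_mkcond [RHS]big_mkcond /=; apply: eq_bigr => E _.
  rewrite inW.
  by case: (E \in edges G); case: (u \in E); case: (v \in E).
have [eq_uv|uv] := eqVneq u v.
  subst v; rewrite adj_irrefl mul1n addn0 /degree.
  rewrite -(card_in_imset (f := fun w => [set u; w])) => [|w z]; last first.
    rewrite !inE => /adj_neq uw /adj_neq uz /setP/(_ w).
    by rewrite !inE eqxx orbT eq_sym (negPf uw) /= => /esym/eqP.
  apply: eq_card => E; rewrite inW andbb; apply/andP/imsetP => [[]|[w]].
    move=> /mem_edges[a [b [ab ->]]]; rewrite !inE => /orP[] /eqP ua.
      by exists b; rewrite ?inE ua.
    by exists a; rewrite ?inE ua 1?adj_sym // setUC.
  rewrite inE => uw ->; split; last by rewrite !inE eqxx.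
  by apply/mem_edges; exists u, w.
rewrite mul0n add0n; case: (boolP (adj u v)) => uv_adj /=.
  rewrite -(cards1 [set u; v]); apply: eq_card => E.
  rewrite inW in_set1.
  apply/andP/eqP => [[/mem_edges[a [b [ab ->]]]]|->].
    rewrite !inE => /andP[/orP[] /eqP ua /orP[] /eqP vb]; subst => //.
    - by rewrite eqxx in uv.
    - by rewrite setUC.
    - by rewrite eqxx in uv.
  split; last by rewrite !inE !eqxx orbT.
  by apply/mem_edges; exists u, v.
apply: eq_card0 => E; rewrite inW; apply/negP.
move=> /andP[/mem_edges[a [b [ab ->]]]].
rewrite !inE => /andP[/orP[] /eqP ua /orP[] /eqP vb]; subst.
- by rewrite eqxx in uv.
- by rewrite ab in uv_adj.
- by rewrite adj_sym ab in uv_adj.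
- by rewrite eqxx in uv.
Qed.

Lemma sum_incidence1 (G : sgraph) (u : G) :
  (\sum_(E : edge G) (u \in val E) = degree u)%N.
Proof.
rewrite -[RHS]addn0 -[RHS]mul1n; have := sum_incidence u u.
rewrite eqxx adj_irrefl mul1n addn0 mul1n addn0 => <-.
by apply: eq_bigr => E _; case: (_ \in _).
Qed.

(** In the central graph [u] keeps its degree through the subdivision vertices
    and gains its non-neighbours: it is joined to [#|G1|.-1] vertices. *)
Lemma degree_corona_vertex (G1 G2 : sgraph) (u : G1) :
  degree (inl (inl u) : central_vertex_corona G1 G2) = (#|G1|.-1 + #|G2|)%N.
Proof.
rewrite degree_sum !big_sumType /=; congr (_ + _)%N.
  rewrite sum_incidence1 degree_sum -big_split /=.
  rewrite -[in RHS](cardC1 u) -sum1_card [RHS]big_mkcond; apply: eq_bigr => v _.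
  rewrite !inE eq_sym; have [->|] := eqVneq v u; first by rewrite adj_irrefl.
  by case: (adj u v).
transitivity (\sum_(v : G1) \sum_(w : G2) (u == v))%N.
  by rewrite pair_bigA; apply: eq_bigr => -[v w].
rewrite (bigD1 u) //= eqxx sum1_card big1 ?addn0 // => v; rewrite eq_sym.
by move=> /negPf->; rewrite big1.
Qed.

Lemma degree_corona_edge (G1 G2 : sgraph) (E : edge G1) :
  degree (inl (inr E) : central_vertex_corona G1 G2) = 2%N.
Proof.
rewrite degree_sum !big_sumType /= [X in (_ + X + _)%N]big1 //.
rewrite [X in (_ + X)%N]big1 => [|[v w] _] //.
rewrite !addn0 -(card_edge_set E) -sum1_card [RHS]big_mkcond.
by apply: eq_bigr => v _; case: (_ \in _).
Qed.

Lemma degree_corona_copy (G1 G2 : sgraph) (u : G1) (w : G2) :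
  degree (inr (u, w) : central_vertex_corona G1 G2) = (degree w).+1.
Proof.
rewrite degree_sum !big_sumType /= [X in (_ + X + _)%N]big1 // addn0.
rewrite -add1n; congr (_ + _)%N.
  by rewrite (bigD1 u) //= eqxx big1 // => v /negPf->.
transitivity (\sum_v \sum_z (u == v) && adj w z)%N.
  by rewrite pair_bigA; apply: eq_bigr => -[v z].
rewrite degree_sum.
rewrite (bigD1 u) //= eqxx [X in (_ + X)%N]big1 ?addn0 // => v; rewrite eq_sym.
by move=> /negPf->; rewrite big1.
Qed.

(** * Schur complements for the corona *)

(** The entry of [x I - Q(G)] in row [a] and column [b]. *)
Definition signless_pencil (K : pzRingType) (G : sgraph) (x : K)
    (a b : G) : K :=
  (a == b)%:R * x - ((a == b)%:R * (degree a)%:R + (adj a b)%:R).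

Lemma scalar_sub_signless (R K : pzRingType) (f : {rmorphism R -> K})
    (G : sgraph) (x : K) :
  x%:M - map_mx f (signless_laplacian R G) = fmx (@signless_pencil K G x).
Proof.
apply/matrixP => i j; rewrite !mxE rmorphD /= rmorph_nat /signless_pencil.
rewrite (inj_eq enum_val_inj).
by case: (i == j); rewrite ?mul1r ?mul0r ?rmorph0 // mulr1n rmorph_nat.
Qed.

Lemma fdet_scalar (K : comPzRingType) (T : finType) (c : K) :
  fdet (fun a b : T => (a == b)%:R * c) = c ^+ #|T|.
Proof.
rewrite -det_scalar; congr (\det _); apply/matrixP => i j; rewrite !mxE.
by rewrite (inj_eq enum_val_inj) mulr_natl.
Qed.

Lemma sum_pred1 (K : pzRingType) (T : finType) (t : T) (F : T -> K) :
  \sum_u (t == u)%:R * F u = F t.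
Proof.
rewrite (bigD1 t) //= eqxx mul1r big1 ?addr0 // => u.
by rewrite eq_sym => /negPf->; rewrite mul0r.
Qed.

Lemma sum_pred1_pair (K : pzRingType) (T1 T2 : finType) (t : T1)
    (F : T1 * T2 -> K) :
  \sum_p (t == p.1)%:R * F p = \sum_u F (t, u).
Proof.
rewrite -(sum_pred1 t (fun t => \sum_u F (t, u))).
under [RHS]eq_bigr do rewrite mulr_sumr.
by rewrite pair_bigA; apply: eq_bigr => -[].
Qed.

Section Corona.

Variables (K : fieldType) (G1 G2 : sgraph) (x : K).

Let CVC := central_vertex_corona G1 G2.
Let M := @signless_pencil K CVC x.
(* The block of [M] on each copy of [G2], where all degrees are raised by 1. *)
Let B := @signless_pencil K G2 (x - 1).

Let M_vertex u v : M (inl (inl u)) (inl (inl v)) =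
  (u == v)%:R * (x - (#|G1|.-1 + #|G2|)%:R) - ((u != v) && ~~ adj u v)%:R.
Proof.
rewrite /M /signless_pencil degree_corona_vertex /=.
have -> : (inl (inl u) == inl (inl v) :> CVC) = (u == v) by [].
by rewrite opprD addrA -mulrBr.
Qed.

Let M_vertex_edge u E : M (inl (inl u)) (inl (inr E)) = - (u \in val E)%:R.
Proof.
rewrite /M /signless_pencil.
have -> : (inl (inl u) == inl (inr E) :> CVC) = false by [].
by rewrite /= !mul0r !add0r.
Qed.

Let M_edge_vertex u E : M (inl (inr E)) (inl (inl u)) = - (u \in val E)%:R.
Proof.
rewrite /M /signless_pencil.
have -> : (inl (inr E) == inl (inl u) :> CVC) = false by [].
by rewrite /= !mul0r !add0r.
Qed.

Let M_edge E E' : M (inl (inr E)) (inl (inr E')) = (E == E')%:R * (x - 2).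
Proof.
rewrite /M /signless_pencil degree_corona_edge.
have -> : (inl (inr E) == inl (inr E') :> CVC) = (E == E') by [].
by rewrite /= addr0 -mulrBr.
Qed.

Let M_vertex_copy u p : M (inl (inl u)) (inr p) = - (u == p.1)%:R.
Proof.
case: p => v w; rewrite /M /signless_pencil.
have -> : (inl (inl u) == inr (v, w) :> CVC) = false by [].
by rewrite /= !mul0r !add0r.
Qed.

Let M_copy_vertex u p : M (inr p) (inl (inl u)) = - (u == p.1)%:R.
Proof.
case: p => v w; rewrite /M /signless_pencil.
have -> : (inr (v, w) == inl (inl u) :> CVC) = false by [].
by rewrite /= !mul0r !add0r.
Qed.

Let M_edge_copy E p : M (inl (inr E)) (inr p) = 0.
Proof.
case: p => v w; rewrite /M /signless_pencil.
have -> : (inl (inr E) == inr (v, w) :> CVC) = false by [].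
by rewrite /= !mul0r !add0r oppr0.
Qed.

Let M_copy_edge E p : M (inr p) (inl (inr E)) = 0.
Proof.
case: p => v w; rewrite /M /signless_pencil.
have -> : (inr (v, w) == inl (inr E) :> CVC) = false by [].
by rewrite /= !mul0r !add0r oppr0.
Qed.

Let M_copy p q : M (inr p) (inr q) = (p.1 == q.1)%:R * B p.2 q.2.
Proof.
case: p q => u w [v z]; rewrite /M /B /signless_pencil degree_corona_copy.
have -> : (inr (u, w) == inr (v, z) :> CVC) = (u == v) && (w == z) by [].
rewrite /=; case: (u == v); case: (w == z); case: (adj w z);
  by rewrite /= -?natr1; ring.
Qed.

Hypothesis unitB : fmx B \in unitmx.
Let chi := \sum_i \sum_j invmx (fmx B) i j.

(* The Schur complement of the block of the copies of [G2]. *)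
Let N (a b : central_graph G1) : K :=
  match a, b with
  | inl u, inl v => M (inl (inl u)) (inl (inl v)) - (u == v)%:R * chi
  | _, _ => M (inl a) (inl b)
  end.

Let fdet_copies : fdet M = fdet B ^+ #|G1| * fdet N.
Proof.
pose Binv w z := invmx (fmx B) (enum_rank w) (enum_rank z).
have BBinv w z : \sum_y B w y * Binv y z = (w == z)%:R.
  have /matrixP/(_ (enum_rank w) (enum_rank z)) := mulmxV unitB.
  rewrite !mxE (inj_eq enum_rank_inj) => <-.
  rewrite -sum_enum_val; apply: eq_bigr => i _.
  by rewrite /Binv !mxE enum_rankK enum_valK.
have chiE : chi = \sum_w \sum_z Binv w z.
  rewrite -[RHS]sum_enum_val; apply: eq_bigr => i _.
  rewrite -[RHS]sum_enum_val; apply: eq_bigr => j _.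
  by rewrite /Binv !enum_valK.
pose E (p q : G1 * G2) := (p.1 == q.1)%:R * Binv p.2 q.2.
rewrite (@fdet_schur _ (central_graph G1) (G1 * G2)%type M E); last first.
  move=> [u w] [v z]; rewrite /E.
  transitivity (\sum_(p : G1 * G2)
      (u == p.1)%:R * (B w p.2 * ((p.1 == v)%:R * Binv p.2 z))).
    by apply: eq_bigr => p _; rewrite M_copy mulrA.
  rewrite sum_pred1_pair /= xpair_eqE -mulnb natrM -BBinv mulr_sumr.
  by apply: eq_bigr => y _; rewrite mulrCA.
congr (_ * _).
  by rewrite -fdet_tensor1; apply: eq_fdet => p q; rewrite M_copy.
apply: eq_fdet => -[u|e] [v|e'] /=.
- congr (_ - _); rewrite chiE.
  transitivity (\sum_(p : G1 * G2) (u == p.1)%:R * \sum_z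
      (v == p.1)%:R * Binv p.2 z).
    apply: eq_bigr => p _; rewrite -(sum_pred1_pair p.1 (fun q : G1 * G2 =>
      (v == q.1)%:R * Binv p.2 q.2)) mulr_sumr.
    by apply: eq_bigr => q _; rewrite M_vertex_copy M_copy_vertex /E; ring.
  rewrite sum_pred1_pair /= eq_sym mulr_sumr; apply: eq_bigr => w _.
  by rewrite mulr_sumr.
- rewrite big1 ?subr0 // => p _; rewrite big1 // => q _.
  by rewrite M_copy_edge mulr0.
- rewrite big1 ?subr0 // => p _; rewrite big1 // => q _.
  by rewrite M_edge_copy !mul0r.
- rewrite big1 ?subr0 // => p _; rewrite big1 // => q _.
  by rewrite M_edge_copy !mul0r.
Qed.

Hypothesis x2 : x - 2 != 0.
Variable r : nat.
Hypothesis reg1 : regular G1 r.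

Let fdet_central : fdet N = (x - 2) ^+ #|edges G1| *
  fdet (fun u v : G1 =>
    (u == v)%:R * (x - #|G1|%:R - #|G2|%:R + 2 - chi - r%:R / (x - 2)) - 1
    + (adj u v)%:R * ((x - 3) / (x - 2))).
Proof.
pose E (e e' : edge G1) := (e == e')%:R * (x - 2)^-1.
rewrite (@fdet_schur _ G1 (edge G1) N E); last first.
  move=> e e'; under eq_bigr do rewrite /N M_edge -mulrA.
  rewrite (sum_pred1 e (fun d => (x - 2) * E d e')) /E.
  by rewrite mulrCA mulfV // mulr1.
congr (_ * _).
  rewrite -card_edge -fdet_scalar; apply: eq_fdet => e e'.
  by rewrite /N M_edge.
apply: eq_fdet => u v.
have -> : \sum_c \sum_d N (inl u) (inr c) * E c d * N (inr d) (inl v) =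
    ((u == v)%:R * r%:R + (adj u v)%:R) / (x - 2).
  transitivity (\sum_(e : edge G1)
      ((u \in val e) * (v \in val e))%N%:R / (x - 2)).
    apply: eq_bigr => e _.
    rewrite -(sum_pred1 e (fun d : edge G1 =>
      ((u \in val e) * (v \in val d))%N%:R / (x - 2))).
    apply: eq_bigr => d _; rewrite /N M_vertex_edge M_edge_vertex /E natrM.
    by ring.
  by rewrite -mulr_suml -natr_sum sum_incidence reg1 natrD natrM.
rewrite /N M_vertex natrD.
have -> : (#|G1|.-1)%:R = #|G1|%:R - 1 :> K.
  by rewrite -subn1 natrB //; apply/card_gt0P; exists u.
have [<-|uv] := eqVneq u v; first by rewrite adj_irrefl /=; field.
by case: (adj u v) => /=; field.
Qed.

(** The determinant of [x I - Q] for the corona reduces to one indexed by the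
    vertices of the regular graph [G1]. *)
Lemma fdet_corona : fdet (@signless_pencil K CVC x) =
  fdet (@signless_pencil K G2 (x - 1)) ^+ #|G1| * ((x - 2) ^+ #|edges G1| *
  fdet (fun u v : G1 =>
    (u == v)%:R * (x - #|G1|%:R - #|G2|%:R + 2 - chi - r%:R / (x - 2)) - 1
    + (adj u v)%:R * ((x - 3) / (x - 2)))).
Proof. by rewrite fdet_copies fdet_central. Qed.

End Corona.

(** * Evaluation on the spectra *)

Lemma det_scalar_sub_sym (R : rcfType) (K : fieldType) (f : {rmorphism R -> K})
    n (A : 'M[R]_n) (y : K) : A^T = A ->
  \det (y%:M - map_mx f A) = \prod_(i < n) (y - f (eigenvalues A)`_i).
Proof.
move=> /sym_diagonalizable[S [d [unitS SA]]].
rewrite (prod_eigenvalues (fun a => y - f a) unitS SA).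
rewrite (@det_similar_diag _ _ (map_mx f S) _ (\row_i (y - f (d 0 i)))).
- by apply: eq_bigr => i _; rewrite mxE.
- by rewrite map_unitmx.
rewrite mulmxBr -map_mxM SA map_mxM map_diag_mx scalar_mxC -mulmxBl.
congr (_ *m _); apply/matrixP => i j; rewrite !mxE.
by case: (i == j); rewrite ?mulr1n // !mulr0n subr0.
Qed.

(** The determinant of [a I + b J + c A] for a connected regular graph. *)
Lemma fdet_regular (R : rcfType) (K : fieldType) (f : {rmorphism R -> K})
    (G : sgraph) (r : nat) (a b c : K) : connected G -> regular G r ->
  fdet (fun u v : G => (u == v)%:R * a + b + (adj u v)%:R * c) =
  \prod_(i < #|G|) (a + b * f (regular_poly R G r).[(adj_eigenvalues R G)`_i]
                    + c * f (adj_eigenvalues R G)`_i).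
Proof.
move=> connG regG; set P := regular_poly R G r.
have [S [d [unitS SA]]] := sym_diagonalizable (adjmx_sym R G).
have SJ := regular_poly_adjmx connG regG unitS SA.
rewrite (prod_eigenvalues (fun l => a + b * f P.[l] + c * f l) unitS SA).
rewrite /fdet (@det_similar_diag _ _ (map_mx f S) _
  (\row_i (a + b * f P.[d 0 i] + c * f (d 0 i)))).
- by apply: eq_bigr => i _; rewrite mxE.
- by rewrite map_unitmx.
have -> : fmx (fun u v : G => (u == v)%:R * a + b + (adj u v)%:R * c) =
    a%:M + b *: map_mx f (const_mx 1) + c *: map_mx f (adjmx R G).
  apply/matrixP => i j; rewrite !mxE (inj_eq enum_val_inj) mulr_natl.
  by rewrite rmorph1 mulr1 rmorph_nat [c * _]mulrC.
rewrite !mulmxDr -!scalemxAr -!map_mxM SJ SA !map_mxM scalar_mxC !scalemxAl.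
rewrite -!mulmxDl; congr (_ *m _); apply/matrixP => i j; rewrite !mxE.
by case: (i == j); rewrite ?mulr1n // !mulr0n rmorph0 !mulr0 !addr0.
Qed.

(** The formula over a field [K]; that [x] avoids the image of [R] makes [x - 2]
    and [x - 1 - Q(G2)] invertible. *)
Lemma det_central_vertex_corona (R : rcfType) (K : fieldType)
    (f : {rmorphism R -> K}) (x : K) (G1 G2 : sgraph) (r : nat) :
    connected G1 -> regular G1 r -> (forall a, x != f a) ->
  let chi := \sum_i \sum_j
    invmx ((x - 1)%:M - map_mx f (signless_laplacian R G2)) i j in
  \det (x%:M - map_mx f (signless_laplacian R (central_vertex_corona G1 G2))) =
    (x - 2) ^ (#|edges G1|%:Z - #|G1|%:Z)
    * (\prod_(j < #|G2|) (x - 1 - f (signless_eigenvalues R G2)`_j) ^+ #|G1|)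
    * \prod_(i < #|G1|)
        ((x - #|G1|%:R - #|G2|%:R + 2 - chi - r%:R / (x - 2)) * (x - 2)
         - (x - 2) * f (regular_poly R G1 r).[(adj_eigenvalues R G1)`_i]
         + (x - 3) * f (adj_eigenvalues R G1)`_i).
Proof.
move=> connG1 regG1 xf.
have x2 : x - 2 != 0 by rewrite subr_eq0 -(rmorph_nat f).
have detB := det_scalar_sub_sym f (x - 1) (signless_laplacian_sym R G2).
rewrite !scalar_sub_signless in detB *; rewrite -/(fdet _) in detB.
have unitB : fmx (@signless_pencil K G2 (x - 1)) \in unitmx.
  rewrite unitmxE unitfE -/(fdet _) detB; apply/prodf_neq0 => i _.
  by rewrite -addrA -opprD subr_eq0 -(rmorph1 f) -rmorphD.
move=> chi; rewrite -[LHS]/(fdet (@signless_pencil K _ x)).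
rewrite (fdet_corona unitB x2 regG1) -/chi.
rewrite (fdet_regular f _ _ _ connG1 regG1) detB.
rewrite prodrXl expfzDr // -invr_expz -!exprnP.
set a := x - #|G1|%:R - #|G2|%:R + 2 - chi - r%:R / (x - 2).
rewrite mulrCA -!mulrA; congr (_ * _).
(* Clear the factor [(x - 2) ^ (- n1)], one [x - 2] per eigenvalue of [A]. *)
apply: (mulfI (expf_neq0 #|G1| x2)); rewrite mulVKf ?expf_neq0 // mulrCA.
congr (_ * _).
have -> : (x - 2) ^+ #|G1| = \prod_(i < #|G1|) (x - 2).
  by rewrite prodr_const card_ord.
rewrite -big_split /=.
by apply: eq_bigr => i _; field.
Qed.

(** * The field of rational functions *)

(** [of_poly] and [of_const] are the canonical embeddings of [{poly R}] and of
    [R] into the field of fractions, hence ring morphisms. *)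
HB.instance Definition _ (R : rcfType) :=
  GRing.RMorphism.copy (@of_poly R) (@tofrac {poly R}).

HB.instance Definition _ (R : rcfType) :=
  GRing.RMorphism.copy (@of_const R) (@tofrac {poly R} \o polyC).

Lemma of_poly_char_poly (R : rcfType) n (A : 'M[R]_n) :
  of_poly (char_poly A) = \det ((of_poly 'X)%:M - map_mx (@of_const R) A).
Proof.
by rewrite /char_poly -det_map_mx map_mxB map_scalar_mx -map_mx_comp.
Qed.

Lemma of_poly_X_neq_const (R : rcfType) (a : R) : of_poly 'X != of_const a.
Proof. by rewrite -subr_eq0 -rmorphB tofrac_eq0 polyXsubC_eq0. Qed.

Theorem theorem3p11 (R : rcfType) (G1 G2 : sgraph) (r1 n1 m1 n2 : nat)
    (hG1 : connected G1) (hG2 : connected G2)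
    (hr1 : regular G1 r1)
    (hn1 : #|G1| = n1) (hm1 : #|edges G1| = m1) (hn2 : #|G2| = n2) :
  let x : ratfun R := of_poly 'X in
  let lambda i : R := (adj_eigenvalues R G1)`_i in
  let gamma j : R := (signless_eigenvalues R G2)`_j in
  let P : {poly R} := regular_poly R G1 r1 in
  let chi : ratfun R -> ratfun R := coronal (signless_laplacian R G2) in
  of_poly (char_poly (signless_laplacian R (central_vertex_corona G1 G2))) =
    (x - 2%:R) ^ (m1%:Z - n1%:Z)
    * (\prod_(j < n2) (x - 1 - of_const (gamma j)) ^+ n1)
    * \prod_(i < n1)
        ((x - n1%:R - n2%:R + 2%:R - chi (x - 1) - r1%:R / (x - 2%:R))
           * (x - 2%:R)
         - (x - 2%:R) * of_const P.[lambda i]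
         + (x - 3%:R) * of_const (lambda i)).
Proof.
move=> x lambda gamma P chi; rewrite of_poly_char_poly -hn1 -hm1 -hn2.
exact: (det_central_vertex_corona G2 hG1 hr1 (@of_poly_X_neq_const R)).
Qed.
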